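(* Let $R$ be a finite commutative ring, let $D=\{\mathcal I_1,\dots,\mathcal I_k\}$ be a set of distinct nonzero principal ideals of $R$, and let $G_R(D)$ be the associated gcd-graph. Write $R=R_1\times R_2$, where $R_1$ (respectively $R_2$) is the product of the local factors of $R$ whose residue field is $\mathbb F_2$ (respectively is not $\mathbb F_2$), let $r$ be the number of local factors of $R$ with residue field $\mathbb F_2$, let $J(R_1)$ be the Jacobson radical of $R_1$, so that $R_1/J(R_1)\cong \mathbb F_2^r$, and let $\Phi\colon R\to R_1/J(R_1)=\mathbb F_2^r$ be the quotient ring homomorphism. Let $D'=\{\Phi(\mathcal I_1),\dots,\Phi(\mathcal I_k)\}$, with any zero ideal removed. Then $G_R(D)$ is connected if and only if the following two conditions hold: 1. $\mathcal I_1+\mathcal I_2+\cdots+\mathcal I_k=R$; 2. the graph $G_{\mathbb F_2^r}(D')$ is connected. Furthermore, suppose that these two conditions hold, and let $t$ be the smallest integer such that there exist $1\le i_1<i_2<\cdots<i_t\le k$ with $\mathcal I_{i_1}+\mathcal I_{i_2}+\cdots+\mathcal I_{i_t}=R$. Then $$t\le \operatorname{diam}(G_R(D))\le 2t+\operatorname{diam}(G_{\mathbb F_2^r}(D')).$$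
   Context: All rings are finite, commutative, associative and unital. For a finite ring $R$ and a set $D$ of nonzero principal ideals of $R$, the gcd-graph $G_R(D)$ is the graph with vertex set $R$ in which $x,y\in R$ are adjacent if and only if $x-y\in S$, where $S=\{s\in R: Rs\in D\}$ is its generating set. Every finite commutative ring is isomorphic to a finite product of local rings, called its local factors. The map $\Phi$ is the projection $R_1\times R_2\to R_1$ followed by the quotient map $R_1\to R_1/J(R_1)$; since it is surjective, each $\Phi(\mathcal I_i)$ is a principal ideal of $\mathbb F_2^r$. If $r=0$, then $\mathbb F_2^r$ is the zero ring. The diameter of a connected graph is the maximum distance between two vertices. *)

(* Defs.v *)
From HB Require Import structures.
From mathcomp Require Import all_boot all_order all_algebra.

Set Implicit Arguments.
Unset Strict Implicit.
Unset Printing Implicit Defensive.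

Import GRing.Theory.
Local Open Scope ring_scope.

(* Rings may be zero rings ([finComPzRingType]): the empty product is the zero
   ring, and it occurs as F_2^r when r = 0. *)

Section Ideals.
Variable R : finComPzRingType.

Definition is_ideal (I : {set R}) : bool :=
  [&& 0 \in I,
      [forall x in I, forall y in I, x + y \in I]
    & [forall a : R, forall x in I, a * x \in I]].

Definition maximal_ideal (M : {set R}) : bool :=
  maxset (fun I => is_ideal I && (I != setT)) M.

Definition jacobson : {set R} :=
  [set x | [forall M : {set R}, maximal_ideal M ==> (x \in M)]].

Definition is_local : Prop := exists! M : {set R}, maximal_ideal M.

Definition principal (s : R) : {set R} := [set a * s | a : R].

Definition ideal_sum (K : finType) (I : K -> {set R}) (A : {set K}) : {set R} :=
  [set x | [exists a : {ffun K -> R},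
              [forall i in A, a i \in I i] && (x == \sum_(i in A) a i)]].

Definition generating_set (D : {set {set R}}) : {set R} :=
  [set s | principal s \in D].

Definition gcd_graph (D : {set {set R}}) : rel R :=
  fun x y => x - y \in generating_set D.

End Ideals.

Arguments jacobson : clear implicits.
Arguments is_local : clear implicits.

(* [q] exhibits [Q] as the quotient ring [R / I]: up to a unique isomorphism
   of the target, [q] is the canonical projection. *)
Definition is_quotient_map (R : finComPzRingType) (I : {set R})
    (Q : pzRingType) (q : {rmorphism R -> Q}) : Prop :=
  (forall y : Q, exists x : R, q x = y) /\ (forall x : R, q x = 0 <-> x \in I).

(* Meant for local rings, where [M] is the unique maximal ideal. *)
Definition residue_field_F2 (R : finComPzRingType) : Prop :=
  exists M : {set R}, maximal_ideal M /\
    exists q : {rmorphism R -> 'F_2}, is_quotient_map M q.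

Section RingProduct.
Variables (K : finType) (L : K -> finComPzRingType).

Definition ringprod : Type := {dffun forall i : K, L i}.

HB.instance Definition _ := Finite.on ringprod.

Implicit Types u v w : ringprod.

Definition rp_zero : ringprod := [ffun i => 0 : L i].
Definition rp_one : ringprod := [ffun i => 1 : L i].
Definition rp_opp u : ringprod := [ffun i => - u i].
Definition rp_add u v : ringprod := [ffun i => u i + v i].
Definition rp_mul u v : ringprod := [ffun i => u i * v i].

Fact rp_addA : associative rp_add.
Proof. by move=> u v w; apply/ffunP=> i; rewrite !ffunE addrA. Qed.
Fact rp_addC : commutative rp_add.
Proof. by move=> u v; apply/ffunP=> i; rewrite !ffunE addrC. Qed.
Fact rp_add0 : left_id rp_zero rp_add.
Proof. by move=> u; apply/ffunP=> i; rewrite !ffunE add0r. Qed.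
Fact rp_addN : left_inverse rp_zero rp_opp rp_add.
Proof. by move=> u; apply/ffunP=> i; rewrite !ffunE addNr. Qed.
Fact rp_mulA : associative rp_mul.
Proof. by move=> u v w; apply/ffunP=> i; rewrite !ffunE mulrA. Qed.
Fact rp_mulC : commutative rp_mul.
Proof. by move=> u v; apply/ffunP=> i; rewrite !ffunE mulrC. Qed.
Fact rp_mul1 : left_id rp_one rp_mul.
Proof. by move=> u; apply/ffunP=> i; rewrite !ffunE mul1r. Qed.
Fact rp_mulD : left_distributive rp_mul rp_add.
Proof. by move=> u v w; apply/ffunP=> i; rewrite !ffunE mulrDl. Qed.

HB.instance Definition _ :=
  GRing.isZmodule.Build ringprod rp_addA rp_addC rp_add0 rp_addN.
HB.instance Definition _ :=
  GRing.Zmodule_isComPzRing.Build ringprod rp_mulA rp_mulC rp_mul1 rp_mulD.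

End RingProduct.

Definition F2pow (r : nat) : finComPzRingType :=
  ringprod (fun _ : 'I_r => 'F_2 : finComPzRingType).

Section Graphs.
Variables (T : finType) (e : rel T).

Definition graph_connected : Prop := forall x y : T, connect e x y.

Definition walk (n : nat) (x y : T) : bool :=
  [exists p : n.-tuple T, path e x p && (last x p == y)].

(* The least length of a walk from [x] to [y]; a shortest walk has fewer than
   [#|T|] edges, so [#|T|] is returned exactly when [y] is unreachable. *)
Definition distance (x y : T) : nat :=
  find (fun n => walk n x y) (iota 0 #|T|).

(* Only meaningful for a connected graph. *)
Definition diameter : nat := (\max_(x : T) \max_(y : T) distance x y)%N.

End Graphs.

(* Main.v *)
Require Import Defs.
From HB Require Import structures.
From mathcomp Require Import all_boot all_order all_algebra.

Set Implicit Arguments.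
Unset Strict Implicit.
Unset Printing Implicit Defensive.

Import GRing.Theory.
Local Open Scope ring_scope.

(** Since [1] is the only unit of [F_2^r], the ideal [Phi (R a)] has [Phi a] as
    its only generator, so walks of [G'] lift to [R] step by step. The lifted walk
    misses its target by some [z] with [Phi z = 0]. Such an element, and each
    of its multiples, is a sum of two units: [1] and [w - 1] work on the
    Jacobson radical, and a residue field other than [F_2] leaves room to avoid
    two classes at once. Writing [1 = \sum_(i in A) c_i a_i] with
    [I_i = R a_i], each term [(z c_i) a_i] is thus a sum of two generators of
    [I_i], so that [2 |A|] further steps reach the target. Conversely, a walk of
    length [n] from [1] to [0] writes [1] as a sum of [n] generators, so at most
    [n] of the ideals already sum to [R]. *)

(** * Walks, distance and diameter in a finite graph *)

Section Walks.
Variables (T : finType) (e : rel T).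

Lemma walkP n (x y : T) :
  reflect (exists p, [/\ size p = n, path e x p & last x p = y]) (walk e n x y).
Proof.
apply: (iffP existsP) => [[p /andP[ep /eqP lp]]|[p [sp ep lp]]].
  by exists p; rewrite size_tuple.
by rewrite -sp; exists (in_tuple p); rewrite /= ep lp eqxx.
Qed.

Lemma walk_connect n (x y : T) : walk e n x y -> connect e x y.
Proof. by case/walkP=> p [_ ep <-]; apply/connectP; exists p. Qed.

Lemma distance_le n (x y : T) : walk e n x y -> (distance e x y <= n)%N.
Proof.
move=> w; rewrite /distance leqNgt; apply/negP => lt.
have ltn : (n < #|T|)%N.
  by apply: leq_trans lt _; rewrite -{2}(size_iota 0 #|T|) find_size.
by have := before_find 0%N lt; rewrite nth_iota // add0n w.
Qed.

(** A connecting path can be shortened to one without repeated vertices, whose length is below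
    [#|T|]; so the search in [distance] succeeds and does not return its default value. *)
Lemma walk_distance (x y : T) : connect e x y -> walk e (distance e x y) x y.
Proof.
case/connectP=> p ep ->; case/shortenP: ep => p' ep' up' _.
have ltp : (size p' < #|T|)%N by have := max_card (mem (x :: p')); rewrite (card_uniqP up').
have hw : has (fun n => walk e n x (last x p')) (iota 0 #|T|).
  apply/hasP; exists (size p'); first by rewrite mem_iota.
  by apply/walkP; exists p'.
have := nth_find 0%N hw; rewrite nth_iota ?add0n //.
by rewrite -[X in (_ < X)%N](size_iota 0 #|T|) -has_find.
Qed.

Lemma distance_diameter (x y : T) : (distance e x y <= diameter e)%N.
Proof.
apply: leq_trans (leq_bigmax x).
exact: (leq_bigmax (F := fun y => distance e x y) y).
Qed.

Lemma diameter_le n :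
  (forall x y, (distance e x y <= n)%N) -> (diameter e <= n)%N.
Proof. by move=> dn; apply/bigmax_leqP => x _; apply/bigmax_leqP => y _. Qed.

End Walks.

(** * Ideals, maximal ideals and units of a finite ring *)

Section FiniteRing.
Variable R : finComPzRingType.
Implicit Types (x y a u : R) (M : {set R}) (D : {set {set R}}).

Lemma is_idealP M :
  reflect [/\ 0 \in M, {in M &, forall x y, x + y \in M}
            & forall a, {in M, forall x, a * x \in M}] (is_ideal M).
Proof.
apply: (iffP and3P) => -[M0 MD MM]; split=> //.
- by move=> x y Mx My; move/forall_inP: MD => /(_ x Mx)/forall_inP; apply.
- by move=> a x Mx; move/forallP: MM => /(_ a)/forall_inP; apply.
- by apply/forall_inP => x Mx; apply/forall_inP => y My; apply: MD.
- by apply/forallP => a; apply/forall_inP => x Mx; apply: MM.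
Qed.

Lemma principalP a x : reflect (exists c, x = c * a) (x \in principal a).
Proof.
by apply: (iffP imsetP) => [[c _ ->]|[c ->]]; exists c.
Qed.

Lemma principal_ideal a : is_ideal (principal a).
Proof.
apply/is_idealP; split=> [|x y|c x].
- by apply/principalP; exists 0; rewrite mul0r.
- move=> /principalP[c ->] /principalP[d ->].
  by apply/principalP; exists (c + d); rewrite mulrDl.
- by move=> /principalP[d ->]; apply/principalP; exists (c * d); rewrite mulrA.
Qed.

Lemma mem_principal a : a \in principal a.
Proof. by apply/principalP; exists 1; rewrite mul1r. Qed.

Lemma principal_eq0 a : principal a = [set 0] -> a = 0.
Proof. by move=> pa; have := mem_principal a; rewrite pa inE => /eqP. Qed.

Lemma ideal_eqT M : is_ideal M -> 1 \in M -> M = setT.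
Proof.
move=> /is_idealP[_ _ MM] M1; apply/setP => x.
by rewrite inE -[x]mulr1 MM.
Qed.

(** Units are expressed throughout as [1 \in principal u]. A unit multiple of a generator is again a
    generator, which supplies the steps of walks inside one ideal. *)
Lemma principal_unitM u a : 1 \in principal u -> principal (u * a) = principal a.
Proof.
case/principalP=> v uv; apply/setP => x.
apply/principalP/principalP => -[c ->].
  by exists (c * u); rewrite mulrA.
by exists (c * v); rewrite mulrA -(mulrA c) -uv mulr1.
Qed.

Lemma nonunit_maximal x :
  1 \notin principal x -> exists2 M, maximal_ideal M & x \in M.
Proof.
move=> x1.
have [|M maxM sxM] := @maxset_exists _
    (fun I : {set R} => is_ideal I && (I != setT)) (principal x).
  rewrite principal_ideal /=; apply: contraNneq x1 => ->.
  by rewrite inE.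
by exists M => //; rewrite (subsetP sxM) ?mem_principal.
Qed.

Lemma maximal_is_ideal M : maximal_ideal M -> is_ideal M.
Proof. by case/maxsetP=> /andP[]. Qed.

Lemma maximal_not1 M : maximal_ideal M -> 1 \notin M.
Proof.
case/maxsetP=> /andP[iM MT] _.
by apply: contra MT => M1; rewrite (ideal_eqT iM M1).
Qed.

Lemma maximal_sub1 M x : maximal_ideal M -> x \in M -> x - 1 \notin M.
Proof.
move=> maxM Mx; apply/negP => Mx1.
have /is_idealP[_ MD MM] := maximal_is_ideal maxM.
have := maximal_not1 maxM; rewrite -[1](subKr x) -mulN1r.
by rewrite MD ?MM.
Qed.

(** Each maximal ideal contains [x], hence not [x - 1]; an element outside all maximal ideals is a
    unit. *)
Lemma jacobson_sub1_unit x : x \in jacobson R -> 1 \in principal (x - 1).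
Proof.
rewrite inE => /forallP Jx; apply/negPn/negP => /nonunit_maximal[M maxM].
by apply/negP/maximal_sub1; rewrite // (implyP (Jx M)).
Qed.

Lemma local_unit M x :
  is_local R -> maximal_ideal M -> x \notin M -> 1 \in principal x.
Proof.
move=> [M0 [_ uniM]] maxM; apply: contraR => /nonunit_maximal[N maxN xN].
by rewrite -(uniM _ maxM) (uniM _ maxN).
Qed.

(** The hypothesis makes the complement of [M] a single coset, so [M] has index two and the
    indicator of its complement is the residue map. *)
Lemma residue_field_F2_index2 M :
  maximal_ideal M ->
  {in [predC M] &, forall x y, x - y \in M} -> residue_field_F2 R.
Proof.
move=> maxM M2; exists M; split=> //.
have /is_idealP[M0 MD MM] := maximal_is_ideal maxM.
have M1 := maximal_not1 maxM.
have MN x : (- x \in M) = (x \in M).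
  by apply/idP/idP => /(MM (-1)); rewrite mulN1r ?opprK.
have MDr x y : y \in M -> (x + y \in M) = (x \in M).
  move=> My; apply/idP/idP => [Mxy|Mx]; last exact: MD.
  by rewrite -(addrK y x) MD ?MN.
have MDn x y : x \notin M -> y \notin M -> x + y \in M.
  by move=> Mx My; rewrite -[y]opprK M2 ?inE ?MN.
have MMn x y : x \notin M -> y \notin M -> x * y \notin M.
  move=> Mx My; have Mx1 : x - 1 \in M by apply: M2; rewrite ?inE.
  by rewrite -(subrK 1 x) mulrDl mul1r addrC MDr // mulrC MM.
pose chi (x : R) : 'F_2 := (x \notin M)%:R.
have chi_zmod : zmod_morphism chi.
  move=> x y; rewrite /chi.
  case: (boolP (y \in M)) => My; first by rewrite MDr ?MN // subr0.
  case: (boolP (x \in M)) => Mx; last by rewrite MDn ?MN // subrr.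
  (* With [x] in [M] and [y] outside, the identity reads [1 = 0 - 1] in ['F_2]. *)
  by rewrite addrC MDr // MN My /=; apply/val_inj.
have chi_monoid : monoid_morphism chi.
  split=> [|x y]; rewrite /chi ?M1 //.
  case: (boolP (x \in M)) => Mx; first by rewrite mulrC MM // mul0r.
  case: (boolP (y \in M)) => My; first by rewrite MM // mulr0.
  by rewrite (MMn _ _ Mx My) mulr1.
pose chiA := GRing.isZmodMorphism.Build _ _ chi chi_zmod.
pose chiM := GRing.isMonoidMorphism.Build _ _ chi chi_monoid.
pose chiR : {rmorphism R -> 'F_2} := HB.pack chi chiA chiM.
exists chiR; split=> [y|x].
  have [->|y0] := eqVneq y 0; first by exists 0; rewrite rmorph0.
  exists 1; rewrite rmorph1; apply/val_inj => /=.
  by case: y y0 => [[|[|[]]]].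
rewrite /chiR /= /chi; case: (x \in M) => //=.
Qed.

Lemma local_sum_two_units x :
  is_local R -> ~ residue_field_F2 R ->
  exists2 u, 1 \in principal u & 1 \in principal (x - u).
Proof.
move=> locR nF2; have [M [maxM _]] := locR.
have unitR := local_unit locR maxM.
(* Inside [M] the decomposition is [x = 1 + (x - 1)]. *)
have [Mx|Mx] := boolP (x \in M).
  by exists 1; rewrite ?mem_principal // unitR ?maximal_sub1.
have [/exists_inP[u Mu xu]|/exists_inPn nu] :=
    boolP [exists u in [predC M], x - u \notin M].
  by exists u; apply: unitR.
have /is_idealP[M0 MD MM] := maximal_is_ideal maxM.
(* If no [u] works, all elements outside [M] are congruent to [x] modulo [M], so [M] has index
   two. *)
case: nF2; apply: (residue_field_F2_index2 maxM) => y z My Mz.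
have := nu z Mz; have := nu y My; rewrite !negbK => xy xz.
have -> : y - z = -1 * (x - y) + (x - z).
  by rewrite mulN1r opprB addrA subrK.
by rewrite MD ?MM.
Qed.

(** * Walks in a gcd-graph as sums of generators *)

Lemma gcd_walkP D n x y :
  reflect (exists s : seq R, [/\ size s = n, {subset s <= generating_set D}
                               & x - y = \sum_(a <- s) a])
          (walk (gcd_graph D) n x y).
Proof.
apply: (iffP (walkP _ _ _ _)) => -[p [<- {n}]].
  elim: p x => [|z p IHp] x /=.
    by move=> _ <-; exists [::]; rewrite big_nil subrr.
  case/andP=> xz /IHp{}IHp /IHp[s [ss sS zy]].
  exists (x - z :: s); split; first by rewrite /= ss.
    by move=> a; rewrite inE => /predU1P[->|/sS].
  by rewrite big_cons -zy addrA subrK.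
elim: p x => [|a p IHp] x sS xy.
  by exists [::]; split=> //=; apply/eqP; rewrite -subr_eq0 xy big_nil.
have [||p' [sp' ep' lp']] := IHp (x - a).
- by move=> b pb; apply: sS; rewrite inE pb orbT.
- by rewrite addrAC xy big_cons addrC addKr.
exists (x - a :: p'); rewrite /= sp' ep' lp'; split=> //.
by rewrite /gcd_graph subKr sS // mem_head.
Qed.

Lemma walk_cat D m n x y z :
  walk (gcd_graph D) m x y -> walk (gcd_graph D) n y z ->
  walk (gcd_graph D) (m + n) x z.
Proof.
move=> /walkP[p [<- ep lp]] /walkP[p' [<- ep' lp']].
by apply/walkP; exists (p ++ p'); rewrite size_cat cat_path last_cat lp ep ep'.
Qed.

(** * Sums of families of ideals *)

Section IdealSum.
Variables (K : finType) (I : K -> {set R}).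
Hypothesis I_ideal : forall i, is_ideal (I i).
Implicit Types A B : {set K}.

Lemma ideal_sumP A x :
  reflect (exists2 a : K -> R, {in A, forall i, a i \in I i}
                             & x = \sum_(i in A) a i)
          (x \in ideal_sum I A).
Proof.
rewrite inE; apply: (iffP existsP) => [[a /andP[/forall_inP aI /eqP ->]]|].
  by exists a.
move=> [a aI ->]; exists [ffun i => a i]; apply/andP; split.
  by apply/forall_inP => i Ai; rewrite ffunE aI.
by apply/eqP/eq_bigr => i _; rewrite ffunE.
Qed.

Lemma ideal_sum_ideal A : is_ideal (ideal_sum I A).
Proof.
apply/is_idealP; split=> [|x y /ideal_sumP[a aI ->] /ideal_sumP[b bI ->]|].
- apply/ideal_sumP; exists (fun=> 0); last by rewrite big1.
  by move=> i _; case/is_idealP: (I_ideal i).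
- apply/ideal_sumP; exists (fun i => a i + b i); last by rewrite big_split.
  by move=> i Ai; case/is_idealP: (I_ideal i) => _ ID _; rewrite ID ?aI ?bI.
- move=> c x /ideal_sumP[a aI ->].
  apply/ideal_sumP; exists (fun i => c * a i); last by rewrite mulr_sumr.
  by move=> i Ai; case/is_idealP: (I_ideal i) => _ _ IM; rewrite IM ?aI.
Qed.

Lemma ideal_sumS A B : A \subset B -> ideal_sum I A \subset ideal_sum I B.
Proof.
move=> sAB; apply/subsetP => x /ideal_sumP[a aI ->].
(* The summands are extended by zero outside [A]. *)
apply/ideal_sumP; exists (fun i => if i \in A then a i else 0) => [i _|].
  by case: ifP => [/aI //|_]; case/is_idealP: (I_ideal i).
rewrite [RHS](big_setID A) /= (setIidPr sAB) [X in _ + X]big1 ?addr0 => [|i].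
  by apply: eq_bigr => i ->.
by rewrite inE => /andP[/negPf->].
Qed.

Lemma sub_ideal_sum A i : i \in A -> I i \subset ideal_sum I A.
Proof.
rewrite -sub1set => Ai; apply: subset_trans (ideal_sumS Ai).
apply/subsetP => x Ix; apply/ideal_sumP; exists (fun=> x); last by rewrite big_set1.
by move=> j; rewrite inE => /eqP ->.
Qed.

(** Each generator contributes one index whose ideal it generates; repeated indices merge, hence
    only an inequality on [#|A|]. *)
Lemma generated_ideal_sum (s : seq R) :
  {subset s <= generating_set [set I i | i : K]} ->
  exists2 A : {set K}, (#|A| <= size s)%N & \sum_(a <- s) a \in ideal_sum I A.
Proof.
elim: s => [|a s IHs] sS.
  exists set0; first by rewrite cards0.
  by rewrite big_nil; case/is_idealP: (ideal_sum_ideal set0).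
have [|A leA sA] := IHs; first by move=> b sb; apply: sS; rewrite inE sb orbT.
have := sS a (mem_head _ _); rewrite inE => /imsetP[i _ ai].
exists (i |: A).
  by rewrite cardsU1 /= -add1n leq_add // leq_b1.
rewrite big_cons; case/is_idealP: (ideal_sum_ideal (i |: A)) => _ ID _.
rewrite ID //; last by rewrite (subsetP (ideal_sumS (subsetUr _ _))).
by rewrite (subsetP (sub_ideal_sum (setU11 _ _))) // -ai mem_principal.
Qed.

End IdealSum.

End FiniteRing.

(** * Units in products of rings, and generators in [F2pow r] *)

Lemma ringprod_units (K : finType) (L : K -> finComPzRingType) (u : ringprod L) :
  (forall i, 1 \in principal (u i)) -> 1 \in principal u.
Proof.
move=> uL; have uLb i : exists c, c * u i == 1.
  by have /principalP[c ->] := uL i; exists c.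
apply/principalP; exists ([ffun i => xchoose (uLb i)] : ringprod L).
by apply/ffunP => i; rewrite !ffunE (eqP (xchooseP (uLb i))).
Qed.

Lemma ringprod_sum_two_units (K : finType) (L : K -> finComPzRingType)
    (x : ringprod L) :
  (forall i, is_local (L i)) -> (forall i, ~ residue_field_F2 (L i)) ->
  exists2 u : ringprod L, 1 \in principal u & 1 \in principal (x - u).
Proof.
move=> locL nF2.
have uL i : exists u, (1 \in principal u) && (1 \in principal (x i - u)).
  have [u u1 u2] := local_sum_two_units (x i) (locL i) (nF2 i).
  by exists u; rewrite u1.
exists ([ffun i => xchoose (uL i)] : ringprod L); apply: ringprod_units => i;
  have /andP[u1 u2] := xchooseP (uL i); by rewrite !ffunE.
Qed.

(** Two generators of one ideal divide each other, so their coordinates vanish at the same places;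
    over ['F_2] this forces equality. *)
Lemma F2pow_principal_inj r : injective (@principal (F2pow r)).
Proof.
move=> x y xy.
have /principalP[c yE] : y \in principal x by rewrite xy mem_principal.
have /principalP[d xE] : x \in principal y by rewrite -xy mem_principal.
have F2 (z : 'F_2) : z = 0 \/ z = 1.
  by case: z => [[|[|[]]] ?] //; [left|right]; apply/val_inj.
apply/ffunP => i; move/ffunP/(_ i): yE; move/ffunP/(_ i): xE; rewrite !ffunE.
by case: (F2 (x i)) (F2 (y i)) => -> [] ->; rewrite ?mulr0.
Qed.

(** * Transfer of walks along a surjective ring morphism *)

Section Lifting.
Variables (R Q : finComPzRingType) (phi : {rmorphism R -> Q}).
Variables (K : finType) (I : K -> {set R}).
Hypothesis I_principal : forall i, exists a : R, I i = principal a.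
Hypothesis phi_surj : forall y, exists x, phi x = y.
Let D := [set I i | i : K].
Let D' := [set phi @: I i | i : K] :\ [set 0].

Lemma imset_principal a : phi @: principal a = principal (phi a).
Proof.
apply/setP=> y; apply/imsetP/principalP => [[_ /principalP[c ->] ->]|[c ->]].
  by exists (phi c); rewrite rmorphM.
have [d <-] := phi_surj c.
by exists (d * a); rewrite ?rmorphM //; apply/principalP; exists d.
Qed.

(** The first alternative arises because the zero ideal is removed from [D']; such a step of a walk
    collapses to a single vertex of the quotient. *)
Lemma generating_set_morph s :
  s \in generating_set D -> phi s = 0 \/ phi s \in generating_set D'.
Proof.
rewrite inE => /imsetP[i _ Ii].
have [->|s0] := eqVneq (phi s) 0; [by left|right].
rewrite !inE; apply/andP; split; first by apply: contraNneq s0 => /principal_eq0->.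
by apply/imsetP; exists i => //; rewrite -Ii imset_principal.
Qed.

Lemma connect_morph x y :
  connect (gcd_graph D) x y -> connect (gcd_graph D') (phi x) (phi y).
Proof.
case/connectP=> p xp ->; elim: p x xp => [|z p IHp] x //= /andP[xz /IHp].
apply: connect_trans; have := generating_set_morph xz.
rewrite rmorphB => -[/subr0_eq-> //|xz']; exact: connect1.
Qed.

Lemma generating_set_lift y :
  injective (@principal Q) -> y \in generating_set D' ->
  exists2 s, s \in generating_set D & phi s = y.
Proof.
move=> injQ; rewrite !inE => /andP[_ /imsetP[i _ yi]].
have [a Ia] := I_principal i; exists a; first by rewrite inE -Ia imset_f.
(* [y] and [phi a] generate the same ideal of [Q], so they are equal. *)
by apply: injQ; rewrite yi Ia imset_principal.
Qed.

Lemma walk_lift n x y :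
  injective (@principal Q) -> walk (gcd_graph D') n (phi x) y ->
  exists2 z, walk (gcd_graph D) n x z & phi z = y.
Proof.
move=> injQ /walkP[p [<- {n}]]; elim: p x => [|v p IHp] x /=.
  by move=> _ <-; exists x => //; apply/walkP; exists [::].
case/andP=> xv vp py; have [s Ss sE] := generating_set_lift injQ xv.
have phi_xs : phi (x - s) = v by rewrite rmorphB sE subKr.
rewrite -phi_xs in vp py; have [z /walkP[q [<- xq qz]] zy] := IHp _ vp py.
exists z => //; apply/walkP; exists (x - s :: q); split=> //=.
by rewrite /gcd_graph subKr Ss.
Qed.

Hypothesis two_units : forall w, phi w = 0 ->
  exists2 u, 1 \in principal u & 1 \in principal (w - u).

Lemma walk_fiber (A : {set K}) x y :
  ideal_sum I A = setT -> phi x = phi y ->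
  walk (gcd_graph D) (2 * #|A|) x y.
Proof.
move=> AT xy.
have I_ideal i : is_ideal (I i).
  by have [a ->] := I_principal i; apply: principal_ideal.
have : 1 \in ideal_sum I A by rewrite AT inE.
case/ideal_sumP=> // b bI b1.
have SD i u a : I i = principal a -> 1 \in principal u ->
    u * a \in generating_set D.
  by move=> Ia u1; rewrite inE principal_unitM // -Ia imset_f.
have step i : i \in A -> exists uv : R * R, [&& uv.1 \in generating_set D,
    uv.2 \in generating_set D & (x - y) * b i == uv.1 + uv.2].
  move=> Ai; have [a Ia] := I_principal i.
  have := bI i Ai; rewrite Ia => /principalP[c bE].
  (* With [b i = c * a], the multiple [(x - y) * c] still maps to zero, so it splits into two units,
     each turning [a] into a generator. *)
  have [|u u1 u2] := two_units (w := (x - y) * c).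
    by rewrite rmorphM rmorphB xy subrr mul0r.
  exists (u * a, ((x - y) * c - u) * a); rewrite !(SD i) //=.
  by rewrite bE mulrA -mulrDl subrKC.
have -> : x = y + \sum_(i <- enum A) (x - y) * b i.
  by rewrite big_enum /= -mulr_sumr -b1 mulr1 addrC subrK.
have : {subset enum A <= A} by move=> i; rewrite mem_enum.
(* The walk starts at [y] plus the terms still to be removed; each index costs two steps. *)
rewrite cardE; elim: (enum A) => [|i e IHe] eA.
  by rewrite big_nil addr0; apply/walkP; exists [::].
have [[u v] /= /and3P[Su Sv /eqP uvE]] := step i (eA i (mem_head _ _)).
rewrite /= mulnS big_cons uvE.
apply: walk_cat _ (IHe _); last by move=> j ej; apply: eA; rewrite inE ej orbT.
apply/gcd_walkP; exists [:: u; v]; split=> //.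
  by move=> w; rewrite mem_seq2 => /pred2P[] ->.
by rewrite !big_cons big_nil addr0 [_ + (u + v + _)]addrCA addrK.
Qed.

Lemma walk_of_quotient_walk (A : {set K}) n x y :
  injective (@principal Q) -> ideal_sum I A = setT ->
  walk (gcd_graph D') n (phi x) (phi y) ->
  walk (gcd_graph D) (2 * #|A| + n) x y.
Proof.
move=> injQ AT /(walk_lift injQ)[z xz zy].
by rewrite addnC; apply: walk_cat xz _; apply: walk_fiber.
Qed.

End Lifting.

(** * The connectivity criterion and the diameter bounds *)

Theorem theorem3p6
  (R : finComPzRingType)
  (k : nat) (I : 'I_k -> {set R})
  (I_distinct : injective I)
  (I_principal : forall i, exists a : R, I i = principal a)
  (I_nonzero : forall i, I i <> [set 0])
  (r s : nat)
  (L1 : 'I_r -> finComPzRingType) (L2 : 'I_s -> finComPzRingType)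
  (L1_local : forall i, is_local (L1 i))
  (L2_local : forall j, is_local (L2 j))
  (L1_residue : forall i, residue_field_F2 (L1 i))
  (L2_residue : forall j, ~ residue_field_F2 (L2 j))
  (f : {rmorphism R -> (ringprod L1 * ringprod L2)%type})
  (f_iso : bijective f)
  (q : {rmorphism ringprod L1 -> F2pow r})
  (q_quotient : is_quotient_map (jacobson (ringprod L1)) q) :
  let Phi := fun x : R => q (f x).1 in
  let D : {set {set R}} := [set I i | i : 'I_k] in
  let D' : {set {set F2pow r}} := [set Phi @: I i | i : 'I_k] :\ [set 0] in
  let G := gcd_graph D in
  let G' := gcd_graph D' in
  (graph_connected G <-> (ideal_sum I setT = setT /\ graph_connected G'))
  /\
  (ideal_sum I setT = setT -> graph_connected G' ->
   forall t : nat,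
     (exists2 A : {set 'I_k}, #|A| = t & ideal_sum I A = setT) ->
     (forall A : {set 'I_k}, ideal_sum I A = setT -> (t <= #|A|)%N) ->
     (t <= diameter G)%N /\ (diameter G <= 2 * t + diameter G')%N).
Proof.
move=> Phi D D' G G'.
have I_ideal i : is_ideal (I i).
  by have [a ->] := I_principal i; apply: principal_ideal.
have [q_surj q_ker] := q_quotient; have [g fK gK] := f_iso.
(* [Phi] is a bare function; the transfer lemmas require a ring morphism. *)
have [phi phiE] : exists phi : {rmorphism R -> F2pow r}, phi =1 Phi.
  by exists (q \o fst \o f : {rmorphism R -> F2pow r}).
have D'E : D' = [set phi @: I i | i : 'I_k] :\ [set 0].
  by congr (_ :\ _); apply: eq_imset => i; apply: eq_imset => x; rewrite phiE.
rewrite {}/G' {D'}D'E.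
have phi_surj y : exists x, phi x = y.
  by have [x <-] := q_surj y; exists (g (x, 0)); rewrite phiE /Phi gK.
have two_units w : phi w = 0 ->
    exists2 u, 1 \in principal u & 1 \in principal (w - u).
  (* The first component of [f w] lies in the Jacobson radical, so there the units are [1] and
     [(f w).1 - 1], the latter with inverse [c]. *)
  rewrite phiE => /q_ker/jacobson_sub1_unit/principalP[c w1].
  have [u /principalP[d u1] /principalP[d' wu]] :=
    ringprod_sum_two_units (f w).2 L2_local L2_residue.
  (* Inverses are formed componentwise and pulled back through [g]. *)
  exists (g (1, u)); apply/principalP; [exists (g (1, d))|exists (g (c, d'))];
    apply: (can_inj fK); rewrite rmorphM ?rmorphB rmorph1 !gK.
    by transitivity (1 * 1 : ringprod L1, d * u); first rewrite mul1r -u1.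
  by transitivity (c * ((f w).1 - 1), d' * ((f w).2 - u)); first rewrite -w1 -wu.
have lower : graph_connected G -> exists2 A : {set 'I_k},
    (#|A| <= diameter G)%N & ideal_sum I A = setT.
  (* A shortest walk from [1] to [0] writes [1] as a sum of at most [diameter G] generators. *)
  move=> conG; have /gcd_walkP[e [se eS]] := walk_distance (conG 1 0).
  rewrite subr0 => e1; have [A leA eA] := generated_ideal_sum I_ideal eS.
  exists A; first by rewrite (leq_trans leA) // se distance_diameter.
  by apply: ideal_eqT; rewrite ?ideal_sum_ideal ?e1.
have upper := walk_of_quotient_walk I_principal phi_surj two_units
  (@F2pow_principal_inj r).
have conGP : graph_connected G <->
    ideal_sum I setT = setT /\
    graph_connected (gcd_graph ([set phi @: I i | i : 'I_k] :\ [set 0])).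
  split=> [conG|[IT conG'] x y].
    split=> [|u v].
      have [A _ AT] := lower conG; apply/eqP; rewrite -subTset -AT.
      by apply: ideal_sumS => //; apply: subsetT.
    have [x <-] := phi_surj u; have [y <-] := phi_surj v.
    by apply: connect_morph.
  apply: walk_connect; apply: upper IT _.
  exact: walk_distance.
split=> // IT conG' t [A <- AT] mint; split.
  have [|B leB BT] := lower; first exact/conGP.
  exact: leq_trans (mint B BT) leB.
(* A shortest quotient walk from [phi x] to [phi y] is lifted, then corrected by [2 * #|A|]
   steps. *)
apply: diameter_le => x y; apply: leq_trans (distance_le (upper _ _ _ _ AT _)) _.
  exact: walk_distance.
by rewrite leq_add2l distance_diameter.
Qed.
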